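(* Let $X$ be a non-singular, projective, non-hyperelliptic curve of genus $g\ge3$ over an algebraically closed field $k$ of characteristic $\ne 2$, whose canonical ideal is generated by quadrics, and let $G\subset\mathrm{Aut}(X)$ be a finite group. Let $0\to\langle E\rangle\to\Gamma'\to\Gamma\to0$ be a small extension of local Artin algebras with residue field $k$, and let $(X_\Gamma,G)$ be a deformation of $(X,G)$ over $\Gamma$. Suppose two lifts of $(X_\Gamma,G)$ to $\Gamma'$ are given as follows: the first has canonical ideal generated by the quadratic forms with symmetric matrices $A_1^{\Gamma'},\ldots,A_r^{\Gamma'}$ and $G$-action given by a representation $\rho_{\Gamma'}$; the second has canonical ideal generated by the quadratic forms with matrices $A_i^{\Gamma'}+E\cdot B_i$, $B_i\in\mathcal S_g(k)$, and $G$-action given by the representation $\sigma\mapsto\rho_{\Gamma'}(\sigma)+E\cdot\tau(\sigma)$, $\tau(\sigma)\in M_g(k)$. Let $f\in\mathrm{Hom}_S(I_X,S/I_X)$ be the homomorphism with $f(A_i)=B_i$, with class $[f]\in H^1(X,\mathcal T_X)^G$, and let $D_\sigma$, $B_\sigma[f]$, $D^{(1)}_{\sigma^{-1}}$ be the associated cocycles as defined in the context. Then for every $\sigma\in G$ the following compatibility condition is satisfied (as an identity of maps $I_X\to S/I_X$): $$\psi_{D_\sigma}-\psi_{B_\sigma[f]}=D^{(1)}_{\sigma^{-1}}.$$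
   Context: $S=\mathrm{Sym}\,H^0(X,\Omega_X)=k[\omega_1,\ldots,\omega_g]$, $\omega=(\omega_1,\ldots,\omega_g)^t$, and $I_X\subset S$ is the homogeneous ideal of the canonical embedding $i:X\hookrightarrow\mathbb P^{g-1}$. $\mathcal S_g(\Gamma)$ denotes symmetric $g\times g$ matrices over $\Gamma$; a symmetric matrix $A$ is identified with the quadratic form $\omega^tA\omega$. Let $r=\binom{g-2}{2}$ and let $A_1,\ldots,A_r\in\mathcal S_g(k)$ be a basis of the space of matrices of the quadrics in $I_X$; these generate $I_X$. The matrices $A_i^\Gamma\in\mathcal S_g(\Gamma)$ lift $A_i$ and generate the canonical ideal of $X_\Gamma$, and $A_i^{\Gamma'}$ lift $A_i^\Gamma$. A small extension means that $\Gamma'\to\Gamma$ is surjective with kernel a principal ideal generated by $E$ with $E\cdot\mathfrak m_{\Gamma'}=0$; so $E\cdot x$ makes sense for $x\in k$. $G$ acts on forms through matrices: $\rho:G\to\mathrm{GL}_g(k)$ is the homomorphism such that $\sigma$ acts on a quadratic form with matrix $A$ by $T(\sigma)A=\rho(\sigma^{-1})^tA\,\rho(\sigma^{-1})$ (i.e. by the substitution $\omega\mapsto\rho(\sigma^{-1})\omega$), coming from the action of $G$ on $H^0(X,\Omega_X)$; similarly over $\Gamma,\Gamma'$ with $\rho_\Gamma,\rho_{\Gamma'}$ lifting $\rho$. Write $T(\sigma^{-1})A_i=\sum_j\lambda_{ij}(\sigma)A_j$. That the two lifts carry $G$-actions means: there are $\lambda^{\Gamma'}_{ij}(\sigma)\in\Gamma'$,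 reducing to $\lambda_{ij}(\sigma)$ in $k$, and $\mu_{ij}(\sigma)\in k$ with $$\rho_{\Gamma'}(\sigma)^tA_i^{\Gamma'}\rho_{\Gamma'}(\sigma)=\sum_j\lambda^{\Gamma'}_{ij}(\sigma)A_j^{\Gamma'},$$ $$(\rho_{\Gamma'}(\sigma)+E\tau(\sigma))^t(A_i^{\Gamma'}+EB_i)(\rho_{\Gamma'}(\sigma)+E\tau(\sigma))=\sum_j(\lambda^{\Gamma'}_{ij}(\sigma)+E\mu_{ij}(\sigma))(A_j^{\Gamma'}+EB_j).$$ For $B\in M_g(k)$, $\psi_B\in\mathrm{Hom}_S(I_X,S/I_X)$ is the degree-preserving $S$-linear map $\omega^tA_i\omega\mapsto\omega^t(A_iB+B^tA_i)\omega \bmod I_X$; it depends only on the class of $B$ modulo scalar matrices $\langle\mathbb I_g\rangle$, and $B\mapsto\psi_B$ is injective on $M_g(k)/\langle\mathbb I_g\rangle$. Degree-preserving homomorphisms $I_X\to S/I_X$ are identified with $H^0(X,\mathcal N_{X/\mathbb P^{g-1}})$ and $H^1(X,\mathcal T_X)$ with $H^0(X,\mathcal N_{X/\mathbb P^{g-1}})/\mathrm{Im}\,\psi$. Put $({}^\sigma f)=T(\sigma)\circ f\circ T(\sigma^{-1})$. The cocycles are: - $D_\sigma=\tau(\sigma)\rho(\sigma)^{-1}\in M_g(k)$ (the cocycle measuring the difference of the two lifts of the representation $\rho_\Gamma$); - $B_\sigma[f]\in M_g(k)/\langle\mathbb I_g\rangle$ is the unique class with ${}^\sigma f-f=\psi_{B_\sigma[f]}$;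 - $D^{(1)}_{\sigma^{-1}}$ is the map $A_i\mapsto\sum_{j=1}^r\sum_{\nu=1}^r\mu_{ij}(\sigma)\lambda_{j\nu}(\sigma^{-1})A_\nu$ (the cocycle measuring the difference of the two induced lifts of the representation $\rho^{(1)}$ of $G$ on the span of $A_1,\ldots,A_r$). *)

(* Defs.v *)
From HB Require Import structures.
From mathcomp Require Import all_boot all_order all_algebra fingroup.
From mathcomp Require Import ring_quotient boolp mpoly.

Set Implicit Arguments.
Unset Strict Implicit.
Unset Printing Implicit Defensive.

Import GRing.Theory.
Local Open Scope ring_scope.

(* A non-singular projective curve X over an algebraically closed field k is
   given by its function field K (finitely generated of transcendence degree 1
   over k); its closed points are the valuation rings of K/k.  The K-space of
   rational differentials is given by its universal property. *)

Section FunctionField.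
Variables (k K : fieldType) (cst : {rmorphism k -> K}).

Definition transcendental (t : K) : Prop :=
  forall q : {poly k}, q != 0 -> (map_poly cst q).[t] != 0.

Definition in_kt (t z : K) : Prop :=
  exists q1 q2 : {poly k},
    (map_poly cst q2).[t] != 0 /\ z = (map_poly cst q1).[t] / (map_poly cst q2).[t].

(* [K : k(t)] = n *)
Definition degree_over_kt (t : K) (n : nat) : Prop :=
  exists e : 'I_n -> K,
    (forall z, exists c : 'I_n -> K,
        (forall i, in_kt t (c i)) /\ z = \sum_i c i * e i) /\
    (forall c : 'I_n -> K,
        (forall i, in_kt t (c i)) -> \sum_i c i * e i = 0 -> forall i, c i = 0).

Definition function_field_one_var : Prop :=
  exists t n, transcendental t /\ degree_over_kt t n.

Definition is_derivation (V : lmodType K) (D : K -> V) : Prop :=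
  [/\ forall x y, D (x + y) = D x + D y,
      forall x y, D (x * y) = x *: D y + y *: D x
    & forall a : k, D (cst a) = 0].

Definition is_kaehler (V : lmodType K) (d : K -> V) : Prop :=
  is_derivation d /\
  forall (W : lmodType K) (D : K -> W), is_derivation D ->
    exists h : {linear V -> W},
      (forall x, h (d x) = D x) /\
      (forall h' : {linear V -> W}, (forall x, h' (d x) = D x) -> h' =1 h).

Definition valuation_ring (O : K -> Prop) : Prop :=
  [/\ forall a : k, O (cst a),
      forall x y, O x -> O y -> O (x - y) /\ O (x * y),
      exists x, ~ O x
    & forall x, O x \/ O x^-1].

End FunctionField.

Record curve (k : fieldType) := Curve {
  fun_field : fieldType;
  const : {rmorphism k -> fun_field};
  diff : lmodType fun_field;
  dd : fun_field -> diff;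
  _ : function_field_one_var const;
  _ : is_kaehler const dd
}.

Section Curve.
Variables (k : fieldType) (X : curve k).

(* v lies in the image of the differentials of the local ring O *)
Definition regular_at (O : fun_field X -> Prop) (v : diff X) : Prop :=
  exists n (a b : 'I_n -> fun_field X),
    (forall i, O (a i) /\ O (b i)) /\ v = \sum_i a i *: dd (b i).

Definition regular_diff (v : diff X) : Prop :=
  forall O, valuation_ring (const X) O -> regular_at O v.

(* The existence of such a w says that X has genus g. *)
Definition regular_basis g (w : 'I_g -> diff X) : Prop :=
  [/\ forall i, regular_diff (w i),
      forall c : 'I_g -> k,
        \sum_i const X (c i) *: w i = 0 -> forall i, c i = 0
    & forall v, regular_diff v -> exists c : 'I_g -> k,
        v = \sum_i const X (c i) *: w i].

(* X has a morphism of degree 2 onto the projective line *)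
Definition hyperelliptic : Prop :=
  exists t, transcendental (const X) t /\ degree_over_kt (const X) t 2.

(* The homogeneous ideal of the canonical image of X, i.e. the kernel of
   Sym H^0(X, Omega_X) -> \bigoplus_n H^0(X, Omega_X^n).  The space [diff X] is
   one-dimensional over the function field, so a nonzero linear form phi
   identifies each Omega^n with the function field, and a homogeneous F of
   degree n is in the kernel iff F(phi(w_1), ..., phi(w_g)) = 0.  Replacing phi
   by its multiples by the infinitely many constants shows that the condition
   below on an arbitrary F bears on each homogeneous component of F. *)
Definition canonical_ideal g (w : 'I_g -> diff X) : {pred {mpoly k[g]}} :=
  fun F => `[< forall phi : {linear diff X -> (fun_field X)^o},
                 mmap (const X) (fun i => phi (w i) : fun_field X) F = 0 >].

Fact canonical_ideal_idealr g (w : 'I_g -> diff X) :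
  idealr_closed (canonical_ideal w).
Proof.
split.
- by apply/asboolP => phi; rewrite rmorph0.
- apply/negP => /asboolP /(_ \0) /eqP.
  by rewrite rmorph1 oner_eq0.
- move=> a u v /asboolP uI /asboolP vI; apply/asboolP => phi.
  by rewrite rmorphD rmorphM /= uI vI mulr0 addr0.
Qed.

HB.instance Definition _ g (w : 'I_g -> diff X) :=
  isIdealr.Build {mpoly k[g]} (canonical_ideal w) (canonical_ideal_idealr w).

Definition generated_by_quadrics g (I : {pred {mpoly k[g]}}) : Prop :=
  forall F, F \in I -> exists n (c Q : 'I_n -> {mpoly k[g]}),
    (forall i, Q i \in I /\ Q i \is 2.-homog) /\ F = \sum_i c i * Q i.

(* A finite group G of automorphisms of X, through its left action on the
   function field, together with the induced action on differentials,
   sigma (a db) = sigma(a) d(sigma b). *)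
Record curve_action (G : finGroupType) := CurveAction {
  act_fun : G -> {rmorphism fun_field X -> fun_field X};
  act_diff : G -> {additive diff X -> diff X};
  _ : forall s a, act_fun s (const X a) = const X a;
  _ : forall z, act_fun 1%g z = z;
  _ : forall s t z, act_fun (s * t)%g z = act_fun s (act_fun t z);
  _ : forall s, (forall z, act_fun s z = z) -> s = 1%g;
  _ : forall s a v, act_diff s (a *: v) = act_fun s a *: act_diff s v;
  _ : forall s z, act_diff s (dd z) = dd (act_fun s z)
}.

End Curve.

Definition qform (R : comNzRingType) g (A : 'M[R]_g) : {mpoly R[g]} :=
  \sum_i \sum_j A i j *: ('X_i * 'X_j).

Definition is_representation (R : comNzRingType) g (G : finGroupType)
    (rho : G -> 'M[R]_g) : Prop :=
  rho 1%g = 1%:M /\ forall s t, rho (s * t)%g = rho s *m rho t.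

(* T(s), the substitution w |-> rho(s^-1) w; on forms of degree 2 it maps the
   form of A to that of rho(s^-1)^t A rho(s^-1). *)
Definition subst_act (R : comNzRingType) g (G : finGroupType)
    (rho : G -> 'M[R]_g) (s : G) (F : {mpoly R[g]}) : {mpoly R[g]} :=
  F \mPo [tuple \sum_j rho s^-1%g i j *: 'X_j | i < g].

(* rho comes from the action on H^0(X, Omega_X): s acts on the coordinate w_i
   of Sym H^0(X, Omega_X) as [subst_act rho s] does. *)
Definition canonical_representation (k : fieldType) (X : curve k) g
    (w : 'I_g -> diff X) (G : finGroupType) (a : curve_action X G)
    (rho : G -> 'M[k]_g) : Prop :=
  is_representation rho /\
  forall s i, act_diff a s (w i) = \sum_j const X (rho s^-1%g i j) *: w j.

Definition quadric_basis (k : fieldType) g r (I : {pred {mpoly k[g]}})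
    (A : 'I_r -> 'M[k]_g) : Prop :=
  [/\ forall i, (A i)^T = A i /\ qform (A i) \in I,
      forall c : 'I_r -> k, \sum_i c i *: A i = 0 -> forall i, c i = 0
    & forall M : 'M[k]_g, M^T = M -> qform M \in I ->
        exists c : 'I_r -> k, M = \sum_i c i *: A i].

(* M/J is handled through representatives: a bilinear map on
   N x M/J is a bilinear map on N x M vanishing on N x J. *)

Section Flat.
Variables (R : comNzRingType) (M : lmodType R) (J : M -> Prop).

Definition bilinear_mod (N P : lmodType R) (b : N -> M -> P) : Prop :=
  [/\ forall a u v m, b (a *: u + v) m = a *: b u m + b v m,
      forall a u m m', b u (a *: m + m') = a *: b u m + b u m'
    & forall u m, J m -> b u m = 0].

(* \sum_i u_i (x) m_i vanishes in N (x) M/J *)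
Definition tensor_null (N : lmodType R) l (u : 'I_l -> N) (m : 'I_l -> M) :
    Prop :=
  forall (P : lmodType R) (b : N -> M -> P),
    bilinear_mod b -> \sum_i b (u i) (m i) = 0.

Definition flat_quotient : Prop :=
  forall (N N' : lmodType R) (h : {linear N -> N'}), injective h ->
  forall l (u : 'I_l -> N) (m : 'I_l -> M),
    tensor_null (fun i => h (u i)) m -> tensor_null u m.

End Flat.

Definition is_ideal (R : comNzRingType) (J : R -> Prop) : Prop :=
  [/\ J 0, forall x y, J x -> J y -> J (x + y) & forall a x, J x -> J (a * x)].

Definition artinian (R : comNzRingType) : Prop :=
  forall J : nat -> R -> Prop,
    (forall n, is_ideal (J n)) ->
    (forall n x, J n.+1 x -> J n x) ->
    exists n, forall m x, (n <= m)%N -> J n x -> J m x.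

(* with residue field k; the maximal ideal is the kernel of [res] *)
Record local_artin (k : fieldType) := LocalArtin {
  la_ring :> comNzRingType;
  res : {rmorphism la_ring -> k};
  res_surj : forall x, exists y, res y == x;
  _ : forall y, res y != 0 -> exists z, y * z = 1;
  _ : artinian la_ring
}.

(* The condition [eps != 0] makes x |-> eps x an identification of k with the
   kernel. *)
Record small_extension (k : fieldType) (R' R : local_artin k) :=
  SmallExtension {
  proj : {rmorphism R' -> R};
  eps : R';
  _ : forall y, res R (proj y) = res R' y;
  _ : forall x, exists y, proj y = x;
  _ : forall y, proj y = 0 <-> exists z, y = eps * z;
  _ : forall y, res R' y = 0 -> eps * y = 0;
  _ : eps != 0
}.

Section Eps.
Variables (k : fieldType) (R' R : local_artin k) (e : small_extension R' R).

(* E . x for x in k: multiply E by any lift of x *)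
Definition eps_mul (x : k) : R' := eps e * xchoose (res_surj R' x).

Definition eps_mx g (B : 'M[k]_g) : 'M[R']_g := map_mx eps_mul B.

End Eps.

(* Deformations are given by their relative canonical ideal: a deformation of X
   over R is Proj of Sym/J over R, where J is generated by quadratic forms
   lifting those of the A_i and Sym/J is flat over R; the action of G is given
   by a representation lifting rho and preserving J. *)

Definition generated_ideal (R : comNzRingType) g r (A : 'I_r -> 'M[R]_g)
    (F : {mpoly R[g]}) : Prop :=
  exists c : 'I_r -> {mpoly R[g]}, F = \sum_i c i * qform (A i).

Section Deformation.
Variables (k : fieldType) (g r : nat) (G : finGroupType).
Variables (A : 'I_r -> 'M[k]_g) (rho : G -> 'M[k]_g).

Definition is_deformation (R : local_artin k)
    (AR : 'I_r -> 'M[R]_g) (rhoR : G -> 'M[R]_g) : Prop :=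
  [/\ forall i, (AR i)^T = AR i /\ map_mx (res R) (AR i) = A i,
      flat_quotient (generated_ideal AR),
      is_representation rhoR,
      forall s, map_mx (res R) (rhoR s) = rho s
    & forall s F, generated_ideal AR F ->
        generated_ideal AR (subst_act rhoR s F)].

Definition is_lift (R' R : local_artin k) (e : small_extension R' R)
    (AR : 'I_r -> 'M[R]_g) (rhoR : G -> 'M[R]_g)
    (AR' : 'I_r -> 'M[R']_g) (rhoR' : G -> 'M[R']_g) : Prop :=
  [/\ is_deformation AR' rhoR',
      forall i, map_mx (proj e) (AR' i) = AR i
    & forall s, map_mx (proj e) (rhoR' s) = rhoR s].

End Deformation.

(* An element of Hom_S(I, S/I) is represented by a function on S of which only
   the values on I are relevant. *)

Section Hom.
Variables (k : fieldType) (g r : nat) (I : idealr {mpoly k[g]}).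
Local Notation S := {mpoly k[g]}.
Local Notation Q := {ideal_quot I}.
Local Notation cl := (\pi_({ideal_quot I})%qT : S -> Q).

Definition is_hom (h : S -> Q) : Prop :=
  forall a F F', F \in I -> F' \in I -> h (a * F + F') = cl a * h F + h F'.

Definition is_hom_with_values (A C : 'I_r -> 'M[k]_g) (h : S -> Q) : Prop :=
  is_hom h /\ forall i, h (qform (A i)) = cl (qform (C i)).

Variables (G : finGroupType) (rho : G -> 'M[k]_g).

(* The value does not depend on the representative when T(s) preserves I. *)
Definition subst_act_quot (s : G) (x : Q) : Q :=
  cl (subst_act rho s (generic_quotient.repr x)).

Definition conj_hom (s : G) (f : S -> Q) : S -> Q :=
  fun F => subst_act_quot s (f (subst_act rho s^-1%g F)).

(* B represents the class B_s[f] in M_g(k)/<1>, where psi C represents psi_C *)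
Definition represents_cocycle (psi : 'M[k]_g -> S -> Q) (f : S -> Q)
    (s : G) (B : 'M[k]_g) : Prop :=
  forall F, F \in I -> conj_hom s f F - f F = psi B F.

End Hom.

(* Main.v *)
Require Import Defs.
From HB Require Import structures.
From mathcomp Require Import all_boot all_order all_algebra fingroup.
From mathcomp Require Import ring_quotient boolp mpoly.
Import GRing.Theory.
Local Open Scope ring_scope.

Set Implicit Arguments.
Unset Strict Implicit.
Unset Printing Implicit Defensive.

(** The three maps of the identity are linked by the E-linear part of the
    equation saying that the second lift is stable under [s]. Comparing it with
    the equation of the first lift gives, over k ([first_order_relation]),
    <<
      rho^t B_i rho + rho^t A_i tau + tau^t A_i rho
        = \sum_j lambda_ij B_j + \sum_j mu_ij A_j.
    >>
    Now T(s^-1) A_i = \sum_j lambda_ij A_j, which [f] sends to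
    \sum_j lambda_ij B_j. Replacing this sum by means of the relation and
    applying T(s), that is M |-> rho^-t M rho^-1, yields
    <<
      (^s f)(A_i) = B_i + A_i D_s + D_s^t A_i - \sum_j mu_ij T(s) A_j,
    >>
    and the last sum is the value of D^(1)_(s^-1) at A_i since
    T(s) A_j = \sum_nu lambda_jnu(s^-1) A_nu. As f(A_i) = B_i and
    ^s f - f = psi_(B_s[f]), this is the desired identity at A_i.

    It extends to the whole ideal because an S-linear map on the ideal is
    determined by its values at the A_i ([eq_hom_on_generators]). That the A_i
    generate the ideal ([quadrics_generate]) also makes the ideal stable under
    T(s), so that T(s) acts on S/I ([subst_act_quotE]) and ^s f can be computed
    with matrices ([conj_hom_quadric]). *)

(** * Quadratic forms and their matrices *)

Section QuadraticForms.
Variables (R : comNzRingType) (g : nat).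
Implicit Types (M N P : 'M[R]_g).

Local Notation vars := (\col_i 'X_i : 'cV[{mpoly R[g]}]_g).
Local Notation cmx := (map_mx (@mpolyC g R)).

(** With the variables gathered in a column, a linear substitution becomes a
    matrix product, so that its effect on a form can be read off by
    associativity in [subst_act_qform]. *)
Lemma qformE M : qform M = (vars^T *m (cmx M *m vars)) 0 0.
Proof.
rewrite /qform mxE; apply: eq_bigr => i _; rewrite !mxE mulr_sumr.
by apply: eq_bigr => j _; rewrite !mxE mulrCA mul_mpolyC.
Qed.

Lemma qformD M N : qform (M + N) = qform M + qform N.
Proof.
rewrite /qform -big_split; apply: eq_bigr => i _; rewrite -big_split.
by apply: eq_bigr => j _; rewrite mxE scalerDl.
Qed.

Lemma qformZ c M : qform (c *: M) = c *: qform M.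
Proof.
rewrite /qform scaler_sumr; apply: eq_bigr => i _; rewrite scaler_sumr.
by apply: eq_bigr => j _; rewrite mxE scalerA.
Qed.

Lemma qformB M N : qform (M - N) = qform M - qform N.
Proof. by rewrite qformD -scaleN1r qformZ scaleN1r. Qed.

Lemma qform0 : qform (0 : 'M[R]_g) = 0.
Proof. by rewrite -(scale0r 0) qformZ scale0r. Qed.

Lemma qform_sum r (c : 'I_r -> R) (M : 'I_r -> 'M[R]_g) :
  qform (\sum_i c i *: M i) = \sum_i c i *: qform (M i).
Proof.
rewrite (big_morph _ qformD qform0).
by apply: eq_bigr => i _; rewrite qformZ.
Qed.

Lemma qform_delta i j : qform (delta_mx i j : 'M[R]_g) = 'X_i * 'X_j.
Proof.
rewrite /qform (bigD1 i) //= (bigD1 j) //= !mxE !eqxx scale1r.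
rewrite !big1 ?addr0 // => [i' ne|j' /negPf ne]; last first.
  by rewrite mxE ne andbF scale0r.
by rewrite big1 // => j' _; rewrite mxE (negPf ne) scale0r.
Qed.

Lemma subst_act_qform (G : finGroupType) (rho : G -> 'M[R]_g) s M :
  subst_act rho s (qform M) = qform ((rho s^-1%g)^T *m M *m rho s^-1%g).
Proof.
set P := rho _; pose t := [tuple \sum_j P i j *: 'X_j | i < g].
have tE : map_mx (comp_mpoly t) vars = cmx P *m vars.
  apply/matrixP => i j; rewrite !mxE comp_mpolyXU -tnth_nth tnth_mktuple.
  by apply: eq_bigr => l _; rewrite !mxE mul_mpolyC.
have tC : map_mx (comp_mpoly t) (cmx M) = cmx M.
  by apply/matrixP => i j; rewrite !mxE comp_mpolyC.
rewrite /subst_act -/P -/t !qformE.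
rewrite (_ : _ \mPo t = map_mx (comp_mpoly t) (vars^T *m (cmx M *m vars)) 0 0);
  last by rewrite [RHS]mxE.
rewrite !map_mxM -map_trmx tE tC trmx_mul -map_trmx.
by rewrite !mulmxA.
Qed.

End QuadraticForms.

(** Every monomial of degree 2 is some X_i X_j, the form of the symmetric matrix
    (E_ij + E_ji) / 2; this is where the characteristic must differ from 2. *)
Lemma sym_of_2homog (k : fieldType) g (Q : {mpoly k[g]}) :
  2%:R != 0 :> k -> Q \is 2.-homog ->
  exists2 M : 'M[k]_g, M^T = M & Q = qform M.
Proof.
move=> char_k /dhomogP homQ; rewrite [Q]mpolyE.
have: {in msupp Q, forall m, mdeg m = 2} by move=> m /homQ.
elim: (msupp Q) => [|m ms IHms] deg2.
  by exists 0; rewrite ?trmx0 // big_nil qform0.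
have [|M symM MQ] := IHms.
  by move=> m' m'_ms; apply: deg2; rewrite inE m'_ms orbT.
have /deg2 m_deg : m \in m :: ms by rewrite inE eqxx.
have [i mi] : exists i, m i != 0%N.
  apply/existsP; apply: contraT; rewrite negb_exists => /forallP m0.
  suff m_0 : m = 0%MM by rewrite m_0 mdeg0 in m_deg.
  by apply/mnmP => i; rewrite mnm0E; apply/eqP; have := m0 i; rewrite negbK.
have Um : (U_(i) <= m)%MM by rewrite lep1mP.
have /mdeg1P[j /eqP mj] : mdeg (m - U_(i))%MM == 1%N.
  by rewrite -(eqn_add2r (mdeg U_(i)%MM)) -mdegD submK // m_deg mdeg1.
exists ((Q@_m / 2%:R) *: (delta_mx i j + delta_mx j i) + M).
  by rewrite linearD linearZ linearD /= !trmx_delta symM [delta_mx j i + _]addrC.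
rewrite big_cons MQ qformD qformZ qformD !qform_delta ['X_j * _]mulrC.
rewrite -mulr2n -scaler_nat scalerA divfK // -mpolyXD -mj.
by rewrite -{2}(submK Um) addmC.
Qed.

(** * Homomorphisms on an ideal generated by quadrics *)

Section IdealGeneration.
Variables (k : fieldType) (g r : nat) (I : idealr {mpoly k[g]}).
Variable A : 'I_r -> 'M[k]_g.
Hypothesis A_I : forall i, qform (A i) \in I.
Local Notation S := {mpoly k[g]}.
Local Notation Q := {ideal_quot I}.
Local Notation cl := (\pi_({ideal_quot I})%qT : S -> Q).

Lemma eq_class_mod F F' : F - F' \in I -> cl F = cl F'.
Proof. by rewrite Quotient.idealrBE => /eqP. Qed.

(** S-linearity of [h] is only available on the ideal, so membership of the
    partial sums is carried along the induction. *)
Lemma hom_lincomb (h : S -> Q) (c : 'I_r -> S) : is_hom h ->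
  h (\sum_i c i * qform (A i)) = \sum_i cl (c i) * h (qform (A i)).
Proof.
move=> hom; have h0 : h 0 = 0.
  have := hom 1 0 0 (rpred0 _) (rpred0 _).
  by rewrite mulr0 addr0 rmorph1 mul1r => /eqP; rewrite -subr_eq subrr => /eqP.
suff [] : \sum_i c i * qform (A i) \in I /\
  h (\sum_i c i * qform (A i)) = \sum_i cl (c i) * h (qform (A i)) by [].
apply: (big_ind2 (fun x y => x \in I /\ h x = y)).
- by split; rewrite ?rpred0.
- move=> x1 x2 y1 y2 [x1I hx1] [y1I hy1]; split; first exact: rpredD.
  by rewrite -[x1]mul1r hom // rmorph1 mul1r hx1 hy1.
- move=> i _; split; first exact: idealMr.
  by rewrite -[_ * _]addr0 hom // ?h0 ?addr0 // rpred0.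
Qed.

(** The quadrics of the ideal have symmetric matrices, hence are k-linear
    combinations of the forms of the basis. *)
Lemma quadrics_generate : 2%:R != 0 :> k -> quadric_basis I A ->
  generated_by_quadrics I -> forall F, F \in I -> generated_ideal A F.
Proof.
move=> char_k [_ _ spanA] gen F /gen[n [c [q [qP ->]]]].
apply: (big_ind (generated_ideal A)).
- by exists (fun=> 0); rewrite big1 // => i _; rewrite mul0r.
- move=> _ _ [a ->] [b ->]; exists (fun i => a i + b i).
  by rewrite -big_split; apply: eq_bigr => i _; rewrite mulrDl.
- move=> l _; have [qI /(sym_of_2homog char_k)[M symM qM]] := qP l.
  have [|d Md] := spanA M symM; first by rewrite -qM.
  exists (fun i => d i *: c l).
  rewrite qM Md qform_sum mulr_sumr; apply: eq_bigr => i _.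
  by rewrite -scalerAr scalerAl.
Qed.

Section Action.
Variables (G : finGroupType) (rho : G -> 'M[k]_g).
Variable lambda : G -> 'I_r -> 'I_r -> k.
Hypothesis lambdaP : forall s i,
  (rho s)^T *m A i *m rho s = \sum_j lambda s i j *: A j.

Lemma subst_act_quadric s i : subst_act rho s (qform (A i)) =
  \sum_j lambda s^-1%g i j *: qform (A j).
Proof. by rewrite subst_act_qform lambdaP qform_sum. Qed.

Hypothesis gen : forall F, F \in I -> generated_ideal A F.

(** T(s) is a ring endomorphism that maps the span of the generating quadrics
    into itself. *)
Lemma subst_act_stable s F : F \in I -> subst_act rho s F \in I.
Proof.
move=> /gen[c ->]; rewrite /subst_act raddf_sum /= rpred_sum // => i _.
rewrite rmorphM /= -[X in _ * X]/(subst_act rho s _) subst_act_quadric.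
apply: idealMr; apply: rpred_sum => j _.
by rewrite -mul_mpolyC idealMr.
Qed.

(** T(s) descends to S/I because it preserves I, so the representative picked by
    [subst_act_quot] does not matter. *)
Lemma subst_act_quotE s F : subst_act_quot rho s (cl F) = cl (subst_act rho s F).
Proof.
apply: eq_class_mod; rewrite -raddfB; apply: subst_act_stable.
by rewrite Quotient.idealrBE generic_quotient.reprK.
Qed.

(** T(s^-1) turns A_i into the combination of the A_j with coefficients
    lambda_ij(s), f replaces each A_j by B_j, and T(s) acts on the matrix of
    the result. *)
Lemma conj_hom_quadric (B : 'I_r -> 'M[k]_g) f s i :
  is_hom_with_values A B f ->
  conj_hom rho s f (qform (A i)) =
  cl (qform ((rho s^-1%g)^T *m (\sum_j lambda s i j *: B j) *m rho s^-1%g)).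
Proof.
move=> [f_hom f_val]; rewrite /conj_hom subst_act_quadric invgK.
under eq_bigr do rewrite -mul_mpolyC.
rewrite hom_lincomb //; under eq_bigr do rewrite f_val -rmorphM mul_mpolyC.
by rewrite -rmorph_sum -qform_sum /= subst_act_quotE subst_act_qform.
Qed.

End Action.

Lemma eq_hom_on_generators (h h' : S -> Q) :
  (forall F, F \in I -> generated_ideal A F) -> is_hom h -> is_hom h' ->
  (forall i, h (qform (A i)) = h' (qform (A i))) -> {in I, h =1 h'}.
Proof.
move=> gen hom hom' eq_gen F /gen[c ->]; rewrite !hom_lincomb //.
by apply: eq_bigr => i _; rewrite eq_gen.
Qed.

Lemma is_homB (h h' : S -> Q) : is_hom h -> is_hom h' -> is_hom (fun F => h F - h' F).
Proof.
move=> hom hom' a F F' FI F'I; rewrite hom ?hom' //.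
by rewrite opprD addrACA mulrBr.
Qed.

End IdealGeneration.

(** * First-order terms in a small extension *)

Section FirstOrder.
Variables (k : fieldType) (R' R : local_artin k) (e : small_extension R' R).
Local Notation E := (eps e).
Local Notation resm := (map_mx (res R')).
Local Notation lift := (fun x : k => xchoose (res_surj R' x)).

Lemma res_lift x : res R' (lift x) = x.
Proof. exact: eqP (xchooseP (res_surj R' x)). Qed.

Lemma eps_sq : E * E = 0.
Proof.
case: e => p eps0 resP _ kerP mP _ /=; apply: (mP).
by rewrite -resP (kerP eps0).2 ?rmorph0 //; exists 1; rewrite mulr1.
Qed.

(** An element with nonzero residue is a unit, which cannot annihilate the
    nonzero E: so an equation multiplied by E can be read in k. *)
Lemma eps_inj y : E * y = 0 -> res R' y = 0.
Proof.
move=> Ey; have eps_n0 : E != 0 by case: e.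
have unitP : res R' y != 0 -> exists z, y * z = 1.
  by case: R' (y) => ? ? ? unit' ?; apply: unit'.
apply/eqP/negPn/negP => /unitP[z yz]; case/eqP: eps_n0.
by rewrite -[E]mulr1 -yz mulrA Ey mul0r.
Qed.

Lemma eps_mxE m n (M : 'M[k]_(m, n)) : map_mx (eps_mul e) M = E *: map_mx lift M.
Proof. by apply/matrixP => i j; rewrite !mxE. Qed.

Lemma eps_mx_inj m n (M : 'M[R']_(m, n)) : E *: M = 0 -> resm M = 0.
Proof.
move=> /matrixP M0; apply/matrixP => i j; rewrite !mxE; apply: eps_inj.
by have := M0 i j; rewrite !mxE.
Qed.

(** Subtract the equation of the first lift from that of the second. The terms
    in E^2 vanish, and what remains is E times a relation over the larger ring,
    whose residue is the relation claimed. *)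
Lemma first_order_relation g r (A B : 'I_r -> 'M[k]_g) (P T : 'M[k]_g)
    (l m : 'I_r -> k) (i : 'I_r)
    (A' : 'I_r -> 'M[R']_g) (P' : 'M[R']_g) (l' : 'I_r -> R') :
  (forall j, resm (A' j) = A j) -> resm P' = P ->
  (forall j, res R' (l' j) = l j) ->
  P'^T *m A' i *m P' = \sum_j l' j *: A' j ->
  (P' + eps_mx e T)^T *m (A' i + eps_mx e (B i)) *m (P' + eps_mx e T)
    = \sum_j (l' j + eps_mul e (m j)) *: (A' j + eps_mx e (B j)) ->
  P^T *m B i *m P + (P^T *m A i *m T + T^T *m A i *m P)
    = \sum_j l j *: B j + \sum_j m j *: A j.
Proof.
move=> resA resP resl eq0; rewrite /eps_mx !eps_mxE.
under eq_bigr do rewrite eps_mxE.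
set T' := map_mx lift T; set B' := fun j => map_mx lift (B j).
rewrite -/(B' i); have E2 n p (M : 'M[R']_(n, p)) : E *: (E *: M) = 0.
  by rewrite scalerA eps_sq scale0r.
have resB j : resm (B' j) = B j by apply/matrixP => a b; rewrite !mxE res_lift.
have resT : resm T' = T by apply/matrixP => a b; rewrite !mxE res_lift.
have -> : \sum_j (l' j + eps_mul e (m j)) *: (A' j + E *: B' j) =
  \sum_j l' j *: A' j + E *: \sum_j (l' j *: B' j + lift (m j) *: A' j).
  rewrite scaler_sumr -big_split; apply: eq_bigr => j _ /=.
  rewrite /eps_mul scalerDl !scalerDr [X in _ + (_ + X)]scalerA mulrAC eps_sq.
  by rewrite mul0r scale0r addr0 -addrA !scalerA [l' j * _]mulrC.
have -> : (P' + E *: T')^T = P'^T + E *: T'^T by rewrite linearD linearZ.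
rewrite !mulmxDl !mulmxDr !mulmxDl.
(* a product has three factors, so E may have to be pulled out three times *)
do 3!rewrite -?scalemxAl -?scalemxAr.
rewrite !E2 !addr0 eq0 -!addrA => /addrI/eqP.
rewrite -!scalerDr -subr_eq0 -scalerBr => /eqP/eps_mx_inj/eqP.
rewrite map_mxB subr_eq0 !map_mxD !map_mxM -!map_trmx resP resB resT resA.
move=> /eqP->.
rewrite -big_split raddf_sum /=.
apply: eq_bigr => j _; rewrite map_mxD !map_mxZ resA resB resl.
by rewrite -/(lift (m j)) res_lift.
Qed.

End FirstOrder.

(** * The compatibility condition *)

Theorem proposition9
  (* the curve, its canonical ideal and the group *)
  (k : closedFieldType) (char_k : 2%:R != 0 :> k)
  (X : curve k) (g : nat) (g_ge3 : (3 <= g)%N)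
  (w : 'I_g -> diff X) (w_basis : regular_basis w)
  (X_nonhyp : ~ hyperelliptic X)
  (X_quadrics : generated_by_quadrics (canonical_ideal w))
  (G : finGroupType) (act : curve_action X G)
  (rho : G -> 'M[k]_g) (rhoP : canonical_representation w act rho)
  (A : 'I_('C(g - 2, 2)) -> 'M[k]_g)
  (A_basis : quadric_basis (canonical_ideal w) A)
  (lambda : G -> 'I_('C(g - 2, 2)) -> 'I_('C(g - 2, 2)) -> k)
  (lambdaP : forall s i,
     (rho s)^T *m A i *m rho s = \sum_j lambda s i j *: A j)
  (* the small extension, the deformation and its two lifts *)
  (Gam' Gam : local_artin k) (e : small_extension Gam' Gam)
  (AG : 'I_('C(g - 2, 2)) -> 'M[Gam]_g) (rhoG : G -> 'M[Gam]_g)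
  (defG : is_deformation A rho AG rhoG)
  (AG' : 'I_('C(g - 2, 2)) -> 'M[Gam']_g) (rhoG' : G -> 'M[Gam']_g)
  (lift1 : is_lift A rho e AG rhoG AG' rhoG')
  (B : 'I_('C(g - 2, 2)) -> 'M[k]_g) (B_sym : forall i, (B i)^T = B i)
  (tau : G -> 'M[k]_g)
  (lift2 : is_lift A rho e AG rhoG
             (fun i => AG' i + eps_mx e (B i))
             (fun s => rhoG' s + eps_mx e (tau s)))
  (lambda' : G -> 'I_('C(g - 2, 2)) -> 'I_('C(g - 2, 2)) -> Gam')
  (lambda'_res : forall s i j, res Gam' (lambda' s i j) = lambda s i j)
  (lambda'P : forall s i,
     (rhoG' s)^T *m AG' i *m rhoG' s = \sum_j lambda' s i j *: AG' j)
  (mu : G -> 'I_('C(g - 2, 2)) -> 'I_('C(g - 2, 2)) -> k)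
  (muP : forall s i,
     (rhoG' s + eps_mx e (tau s))^T *m (AG' i + eps_mx e (B i))
       *m (rhoG' s + eps_mx e (tau s))
     = \sum_j (lambda' s i j + eps_mul e (mu s i j))
                *: (AG' j + eps_mx e (B j)))
  (* psi, f, and the cocycles *)
  (psi : 'M[k]_g -> {mpoly k[g]} -> {ideal_quot (canonical_ideal w)})
  (psiP : forall C : 'M[k]_g,
     is_hom_with_values A (fun i => A i *m C + C^T *m A i) (psi C))
  (f : {mpoly k[g]} -> {ideal_quot (canonical_ideal w)})
  (fP : is_hom_with_values A B f)
  (D : G -> 'M[k]_g) (DP : forall s, D s = tau s *m invmx (rho s))
  (Bf : G -> 'M[k]_g)
  (BfP : forall s, represents_cocycle rho psi f s (Bf s))
  (* D1 s stands for D^(1)_{s^-1} *)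
  (D1 : G -> {mpoly k[g]} -> {ideal_quot (canonical_ideal w)})
  (D1P : forall s, is_hom_with_values A
     (fun i => \sum_j \sum_nu (mu s i j * lambda s^-1%g j nu) *: A nu) (D1 s))
  (s : G) (F : {mpoly k[g]}) (F_in : F \in canonical_ideal w) :
  psi (D s) F - psi (Bf s) F = D1 s F.
Proof.
have [rho_rep _] := rhoP; have [A_props _ _] := A_basis.
have A_I i : qform (A i) \in canonical_ideal w by have [] := A_props i.
have gen := quadrics_generate char_k A_basis X_quadrics.
have rhoK : rho s *m rho s^-1%g = 1%:M.
  by case: rho_rep => rho1 rhoM; rewrite -rhoM mulgV.
have Ds : D s = tau s *m rho s^-1%g.
  have [_ rho_unit] := mulmx1_unit (mulmx1C rhoK).
  by rewrite DP -[invmx _]mulmx1 -rhoK mulKmx.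
have [[defA' _ _ res_rho' _] _ _] := lift1.
have fst_order i := first_order_relation (fun j => (defA' j).2) (res_rho' s)
  (lambda'_res s i) (lambda'P s i) (muP s i).
have [psiD_hom psiD_val] := psiP (D s); have [D1_hom D1_val] := D1P s.
have [psiB_hom _] := psiP (Bf s).
(* psi of B_s[f] is S-linear by hypothesis, while ^s f - f would have to be
   shown to be; isolating psi of B_s[f] leaves linear maps on both sides. *)
suff eq_psi : {in canonical_ideal w,
    (fun F => psi (D s) F - D1 s F) =1 psi (Bf s)}.
  by rewrite -eq_psi // opprB addrCA subrr addr0.
apply: (eq_hom_on_generators A_I gen) => //; first exact: is_homB.
move=> i; rewrite psiD_val D1_val -(BfP s _ (A_I i)).
rewrite (conj_hom_quadric A_I lambdaP gen s i fP) fP.2.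
rewrite -!raddfB -!qformB; do 2 congr (_ _).
(* By the first-order relation, \sum_j lambda_ij B_j is
   rho^t B_i rho + rho^t A_i tau + tau^t A_i rho - \sum_j mu_ij A_j, and
   T(s) cancels the outer factors rho. *)
rewrite -[in RHS](addrK (\sum_j mu s i j *: A j) (\sum_j _ *: B j)) -fst_order.
have rhoKT : (rho s^-1%g)^T *m (rho s)^T = 1%:M by rewrite -trmx_mul rhoK trmx1.
rewrite Ds !(mulmxDr, mulmxDl, mulmxN, mulNmx) !mulmxA rhoKT !mul1mx.
rewrite -!(mulmxA _ (rho s)) rhoK !mulmx1 trmx_mul [RHS]addrAC [B i + _]addrC.
rewrite addrK; congr (_ - _).
rewrite mulmx_sumr mulmx_suml; apply: eq_bigr => j _.
rewrite -scalemxAr -scalemxAl lambdaP scaler_sumr.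
by apply: eq_bigr => nu _; rewrite scalerA.
Qed.
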